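(* For every formula $A$ of $\mathcal{L}(\forall,\Box)$: if $A$ is logically valid (i.e. $\mathcal{A}\models A$ for every universal structure $\mathcal{A}$), then $A\in\mathsf{FOL\Box}$.
   Context: Language $\mathcal{L}(\forall,\Box)$: first-order language with identity $=$, predicate symbols $P^n_j$, variables, no constants or function symbols, connectives $\neg,\to$, quantifier $\forall$, modal operator $\Box$ (arbitrary nesting); $\Diamond:=\neg\Box\neg$. A formula is $\Box$-free if it contains no $\Box$. $\mathsf{FOL}$ is the set of $\Box$-free theses of classical first-order logic with identity. Semantics: a structure is $\mathcal{A}=\langle \mathcal{W},\{\mathcal{D}_w\}_{w\in\mathcal{W}}, I\rangle$ with $\mathcal{W}\neq\emptyset$, nonempty domains $\mathcal{D}_w$, $I(P^n_j,w)\subseteq \mathcal{D}_w^n$. A valuation $v$ has $v(x,w)\in\mathcal{D}_w$; $v^a_x(w)$ agrees with $v$ except it sends $x$ at $w$ to $a\in\mathcal{D}_w$. $\mathcal{A},v,w\models P^n_j(x_1,\dots,x_n)$ iff $\langle v(x_1,w),\dots,v(x_n,w)\rangle\in I(P^n_j,w)$; $x=y$ iff $v(x,w)=v(y,w)$; $\neg,\to$ classical; $\forall xA$ iff $\mathcal{A},v^a_x(w),w\models A$ for all $a\in\mathcal{D}_w$; $\Box A$ iff $\mathcal{A},v',w'\models A$ for every valuation $v'$ and every world $w'$. $\mathcal{A}\models A$ means satisfaction at all $v,w$. With $\mathfrak{C}$ the class of all such structures, $\mathcal{A}\in\mathfrak{C}$ is universal if for every $\Box$-free $A$, $\mathcal{A}\models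 A$ implies $\mathcal{B}\models A$ for all $\mathcal{B}\in\mathfrak{C}$. An occurrence of $x$ in $A$ is $\forall\Box$-bound if it is in the scope of a quantifier on $x$ or inside the scope of some $\Box$; otherwise $\forall\Box$-free. $x$ is a $\forall\Box$-free variable of $A$ if it has a $\forall\Box$-free occurrence. $A(^y/_x)$ is the simultaneous replacement of every $\forall\Box$-free occurrence of $x$ by $y$, provided $y$ is not captured by a quantifier. $\mathsf{FOL\Box}$ is the smallest set of formulas containing all instances of propositional tautologies and all instances of: $\Box(A\to B)\to(\Box A\to\Box B)$; $\Box A\to A$; $\neg\Box A\to\Box\neg\Box A$; $\forall xA\to A(^y/_x)$ (admissible $\forall\Box$-free substitution); $\forall x(A\to B)\to(A\to\forall xB)$ if $x$ is not $\forall\Box$-free in $A$; $x=x$; $x=y\wedge A(x)\to A(y)$ for $\Box$-free $A$ (usual first-order identity axiom); $\Box A\to\forall xA$; $\neg\Box A$ for every $\Box$-free $A\notin\mathsf{FOL}$; closed under: $A\in\mathsf{FOL\Box}\Rightarrow\Box A\in\mathsf{FOL\Box}$, and modus ponens. *)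

(* Defs.v *)
From mathcomp Require Import all_boot.
From mathcomp Require Import boolp.

Set Implicit Arguments.
Unset Strict Implicit.
Unset Printing Implicit Defensive.

(* [Pred n j t] is the atom P^n_j(t_1, ..., t_n); variables are named by
   natural numbers, and there are no other terms. *)
Inductive formula : Type :=
| Pred (n j : nat) (t : n.-tuple nat)
| Eq (x y : nat)
| Neg (A : formula)
| Imp (A B : formula)
| All (x : nat) (A : formula)
| Box (A : formula).

Definition And (A B : formula) : formula := Neg (Imp A (Neg B)).

Fixpoint box_free (A : formula) : bool :=
  match A with
  | Pred _ _ _ => true
  | Eq _ _ => true
  | Neg B => box_free B
  | Imp B C => box_free B && box_free C
  | All _ B => box_free B
  | Box _ => false
  end.

(* x has an occurrence in A that is neither in the scope of a quantifier on x
   nor in the scope of a box. On box-free formulas this, like [subst] and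
   [admissible] below, is the usual first-order notion. *)
Fixpoint ab_free (x : nat) (A : formula) : bool :=
  match A with
  | Pred _ _ t => x \in tval t
  | Eq y z => (x == y) || (x == z)
  | Neg B => ab_free x B
  | Imp B C => ab_free x B || ab_free x C
  | All y B => (x != y) && ab_free x B
  | Box _ => false
  end.

Definition rename (x y z : nat) : nat := if z == x then y else z.

(* A(y/x); meaningful when [admissible x y A]. *)
Fixpoint subst (x y : nat) (A : formula) : formula :=
  match A with
  | Pred n j t => Pred j (map_tuple (rename x y) t)
  | Eq z1 z2 => Eq (rename x y z1) (rename x y z2)
  | Neg B => Neg (subst x y B)
  | Imp B C => Imp (subst x y B) (subst x y C)
  | All z B => if z == x then All z B else All z (subst x y B)
  | Box B => Box B
  end.

(* No occurrence of x replaced by [subst x y A] lies in the scope of a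
   quantifier on y. *)
Fixpoint admissible (x y : nat) (A : formula) : bool :=
  match A with
  | Pred _ _ _ => true
  | Eq _ _ => true
  | Neg B => admissible x y B
  | Imp B C => admissible x y B && admissible x y C
  | All z B => ~~ ab_free x (All z B) || (z != y) && admissible x y B
  | Box _ => true
  end.

Inductive pform : Type :=
| PVar (i : nat)
| PNeg (p : pform)
| PImp (p q : pform).

Fixpoint peval (e : nat -> bool) (p : pform) : bool :=
  match p with
  | PVar i => e i
  | PNeg q => ~~ peval e q
  | PImp q r => peval e q ==> peval e r
  end.

Definition tautology (p : pform) : Prop := forall e : nat -> bool, peval e p.

Fixpoint pinst (s : nat -> formula) (p : pform) : formula :=
  match p with
  | PVar i => s i
  | PNeg q => Neg (pinst s q)
  | PImp q r => Imp (pinst s q) (pinst s r)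
  end.

(* The theses of a standard Hilbert calculus for classical first-order logic
   with identity. The side conditions keep every line of a derivation
   box-free. *)
Inductive FOL : formula -> Prop :=
| FOL_taut (p : pform) (s : nat -> formula) :
    tautology p -> box_free (pinst s p) -> FOL (pinst s p)
| FOL_inst (x y : nat) (A : formula) :
    box_free A -> admissible x y A -> FOL (Imp (All x A) (subst x y A))
| FOL_dist (x : nat) (A B : formula) :
    box_free A -> box_free B -> ~~ ab_free x A ->
    FOL (Imp (All x (Imp A B)) (Imp A (All x B)))
| FOL_refl (x : nat) : FOL (Eq x x)
| FOL_leib (x y : nat) (A : formula) :
    box_free A -> admissible x y A ->
    FOL (Imp (And (Eq x y) A) (subst x y A))
| FOL_mp (A B : formula) : FOL (Imp A B) -> FOL A -> FOL B
| FOL_gen (x : nat) (A : formula) : FOL A -> FOL (All x A).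

Inductive FOLBox : formula -> Prop :=
| FOLBox_taut (p : pform) (s : nat -> formula) :
    tautology p -> FOLBox (pinst s p)
| FOLBox_K (A B : formula) :
    FOLBox (Imp (Box (Imp A B)) (Imp (Box A) (Box B)))
| FOLBox_T (A : formula) : FOLBox (Imp (Box A) A)
| FOLBox_5 (A : formula) : FOLBox (Imp (Neg (Box A)) (Box (Neg (Box A))))
| FOLBox_inst (x y : nat) (A : formula) :
    admissible x y A -> FOLBox (Imp (All x A) (subst x y A))
| FOLBox_dist (x : nat) (A B : formula) :
    ~~ ab_free x A -> FOLBox (Imp (All x (Imp A B)) (Imp A (All x B)))
| FOLBox_refl (x : nat) : FOLBox (Eq x x)
| FOLBox_leib (x y : nat) (A : formula) :
    box_free A -> admissible x y A ->
    FOLBox (Imp (And (Eq x y) A) (subst x y A))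
| FOLBox_all (x : nat) (A : formula) : FOLBox (Imp (Box A) (All x A))
| FOLBox_nonthesis (A : formula) :
    box_free A -> ~ FOL A -> FOLBox (Neg (Box A))
| FOLBox_nec (A : formula) : FOLBox A -> FOLBox (Box A)
| FOLBox_mp (A B : formula) : FOLBox (Imp A B) -> FOLBox A -> FOLBox B.

Record structure : Type := Structure {
  world : Type;
  world_inh : inhabited world;
  dom : world -> Type;
  dom_inh : forall w : world, inhabited (dom w);
  interp : forall n j : nat, forall w : world, n.-tuple (dom w) -> Prop
}.

Definition valuation (S : structure) : Type :=
  forall (x : nat) (w : world S), dom w.

Definition update (S : structure) (v : valuation S) (x : nat) (w : world S)
    (a : dom w) : valuation S :=
  fun y u =>
    if y == x then
      match pselect (w = u) with
      | left e => eq_rect w (@dom S) a u e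
      | right _ => v y u
      end
    else v y u.

Fixpoint sat (S : structure) (v : valuation S) (w : world S) (A : formula)
    : Prop :=
  match A with
  | Pred n j t => interp j (map_tuple (fun x => v x w) t)
  | Eq x y => v x w = v y w
  | Neg B => ~ sat v w B
  | Imp B C => sat v w B -> sat v w C
  | All x B => forall a : dom w, sat (update v x a) w B
  | Box B => forall (v' : valuation S) (w' : world S), sat v' w' B
  end.

Definition models (S : structure) (A : formula) : Prop :=
  forall (v : valuation S) (w : world S), sat v w A.

Definition universal (S : structure) : Prop :=
  forall A : formula, box_free A -> models S A ->
  forall T : structure, models T A.

Definition logically_valid (A : formula) : Prop :=
  forall S : structure, universal S -> models S A.

(* Main.v *)
From mathcomp Require Import all_boot.
From mathcomp Require Import boolp.
From Stdlib Require Import ClassicalEpsilon.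
Require Import Defs.

Set Implicit Arguments.
Unset Strict Implicit.
Unset Printing Implicit Defensive.

(** A Henkin construction gives a single structure [canon] whose worlds are the
    saturated first-order theories and in which a box-free formula is valid
    exactly when it is a thesis of FOL; in particular [canon] is universal.
    Every formula can be made box-free from the inside out, replacing [Box B],
    with B box-free by then, by a truth or a falsehood according to whether B is
    a thesis of FOL. FOLBox proves the equivalence of A with its reduct (a
    boxed thesis by necessitation, the negation of a boxed non-thesis by axiom),
    and the same equivalence holds in [canon]. So if A holds in [canon], its
    reduct is a thesis of FOL, hence of FOLBox, and A follows. *)

(** * Syntax *)

Fixpoint height (A : formula) : nat :=
  match A with
  | Neg B => (height B).+1
  | Imp B C => (maxn (height B) (height C)).+1
  | All _ B => (height B).+1
  | Box B => (height B).+1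
  | _ => 0
  end.

(* Bound variables count as well; boxed subformulas do not, since substitution
   does not act on them. *)
Fixpoint var_bound (A : formula) : nat :=
  match A with
  | Pred _ _ t => (\max_(x <- tval t) x).+1
  | Eq x y => (maxn x y).+1
  | Neg B => var_bound B
  | Imp B C => maxn (var_bound B) (var_bound C)
  | All x B => maxn x.+1 (var_bound B)
  | Box B => 0
  end.

Lemma height_subst x y A : height (subst x y A) = height A.
Proof.
elim: A => //= [A -> //|A -> B -> //|z A IH].
by case: ifP => //= _; rewrite IH.
Qed.

Lemma box_free_subst x y A : box_free (subst x y A) = box_free A.
Proof.
elim: A => //= [A -> B -> //|z A IH].
by case: ifP => //= _; rewrite IH.
Qed.

Lemma FOL_box_free A : FOL A -> box_free A.
Proof.
elim=> //= {A}.
- by move=> x y A; rewrite box_free_subst => ->.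
- by move=> x A B -> ->.
- by move=> x y A; rewrite box_free_subst => ->.
- by move=> A B _ /andP[].
Qed.

Lemma ab_free_fresh y A : var_bound A <= y -> ~~ ab_free y A.
Proof.
elim: A => //= [n j t|a b|A IHA B IHB|z A IH].
- move=> h; apply/negP => yt.
  by have := @leq_bigmax_seq _ _ xpredT id _ yt isT; rewrite leqNgt h.
- rewrite gtn_max => /andP[ay by_].
  by rewrite negb_or !neq_ltn ay by_ !orbT.
- by rewrite geq_max => /andP[/IHA + /IHB]; rewrite negb_or => -> ->.
- by rewrite geq_max => /andP[_ /IH]; rewrite negb_and => ->; rewrite orbT.
Qed.

Lemma rename_id x y z : z != x -> rename x y z = z.
Proof. by rewrite /rename => /negbTE ->. Qed.

Lemma subst_not_free x y A : ~~ ab_free x A -> subst x y A = A.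
Proof.
elim: A => //= [n j t|a b|A IH|A IHA B IHB|z A IH].
- move=> xt; congr (Pred j _); apply: val_inj => /=.
  rewrite -[RHS]map_id; apply/eq_in_map => z zt; apply: rename_id.
  by apply: contraNneq xt => <-.
- by rewrite negb_or => /andP[xa xb]; rewrite !rename_id // eq_sym.
- by move=> /IH ->.
- by rewrite negb_or => /andP[/IHA -> /IHB ->].
- by case: (eqVneq z x) => //= zx /IH ->.
Qed.

Lemma admissible_fresh x y A : var_bound A <= y -> admissible x y A.
Proof.
elim: A => //= [A IHA B IHB|z A IH].
  by rewrite geq_max => /andP[/IHA -> /IHB ->].
by rewrite geq_max => /andP[zy /IH ->]; rewrite (ltn_eqF zy) orbT.
Qed.

Lemma subst_fresh_free x y A : x != y -> ~~ ab_free x (subst x y A).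
Proof.
move=> xy; elim: A => //= [n j t|a b|A IHA B IHB|z A IH].
- apply/mapP => -[z _]; rewrite /rename; case: eqP => [_ /eqP|+ xz].
    by rewrite (negbTE xy).
  by rewrite -xz.
- rewrite negb_or /rename.
  by case: (eqVneq a x) => [_|ax]; case: (eqVneq b x) => [_|bx];
    rewrite ?xy //= ?(eq_sym x a) ?(eq_sym x b) ?ax ?bx.
- by rewrite negb_or IHA.
- case: (eqVneq z x) => [->|zx] /=; first by rewrite eqxx.
  by rewrite negb_and IH orbT.
Qed.

(** Together with [admissible_freshK], this makes a passage to a fresh variable reversible, which
    [FOL_witness] needs to rename a bound variable back. *)
Lemma subst_freshK x y A : var_bound A <= y -> subst y x (subst x y A) = A.
Proof.
elim: A => //= [n j t|a b|A IH|A IHA B IHB|z A IH].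
- move=> h; congr (Pred j _); apply: val_inj => /=.
  rewrite -map_comp -[RHS]map_id; apply/eq_in_map => z zt /=.
  rewrite /rename; case: (eqVneq z x) => [->|zx]; first by rewrite eqxx.
  have := @leq_bigmax_seq _ _ xpredT id _ zt isT => /= zm.
  by rewrite ltn_eqF // (leq_ltn_trans zm).
- rewrite gtn_max => /andP[ay by_]; rewrite /rename.
  by case: (eqVneq a x) => [->|_]; case: (eqVneq b x) => [->|_];
    rewrite ?eqxx ?(ltn_eqF ay) ?(ltn_eqF by_).
- by move=> /IH ->.
- by rewrite geq_max => /andP[/IHA -> /IHB ->].
- rewrite geq_max => /andP[zy Ay].
  case: (eqVneq z x) => [zx|zx] /=; rewrite (ltn_eqF zy); last by rewrite IH.
  by rewrite subst_not_free // ab_free_fresh.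
Qed.

Lemma admissible_freshK x y A :
  var_bound A <= y -> admissible y x (subst x y A).
Proof.
elim: A => //= [A IHA B IHB|z A IH].
  by rewrite geq_max => /andP[/IHA -> /IHB ->].
rewrite geq_max => /andP[zy Ay].
case: (eqVneq z x) => [zx|zx] /=; last by rewrite zx IH ?orbT.
by rewrite negb_and ab_free_fresh ?orbT.
Qed.

(** * Soundness of first-order logic *)

Section Semantics.
Variable S : structure.
Implicit Types (v : valuation S) (w : world S) (A : formula).

Lemma update_eq v x w (a : dom w) : update v x a x w = a.
Proof.
rewrite /update eqxx; case: pselect => // e.
by rewrite (Prop_irrelevance e erefl).
Qed.

Lemma update_neq v x w (a : dom w) y u : y != x -> update v x a y u = v y u.
Proof. by rewrite /update => /negbTE ->. Qed.

(** The clause for [Box] quantifies over all valuations and worlds afresh, so only the values at [w]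
    of variables free outside boxes can matter. *)
Lemma sat_ext A v v' w : (forall x, ab_free x A -> v x w = v' x w) ->
  sat v w A <-> sat v' w A.
Proof.
elim: A v v' => //= [n j t|a b|A IH|A IHA B IHB|z A IH] v v' h.
- suff -> : map_tuple (v^~ w) t = map_tuple (v'^~ w) t by [].
  by apply: val_inj => /=; apply/eq_in_map => x /h.
- by rewrite !h ?eqxx ?orbT.
- by rewrite (IH v v').
- by rewrite (IHA v v') ?(IHB v v') // => x xf; apply: h; rewrite xf ?orbT.
- split=> H a; [rewrite -(IH (update v z a))|rewrite (IH _ (update v' z a))] => //;
    move=> x xf; (case: (eqVneq x z) => [->|xz]; first by rewrite !update_eq);
    by rewrite !update_neq // h // xz.
Qed.

Lemma sat_subst A x y v w : admissible x y A ->
  sat v w (subst x y A) <-> sat (update v x (v y w)) w A.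
Proof.
have vr v0 z : v0 (rename x y z) w = update v0 x (v0 y w) z w.
  rewrite /rename; case: eqVneq => [->|zx]; first by rewrite update_eq.
  by rewrite update_neq.
elim: A v => //= [n j t|a b|A IH|A IHA B IHB|z A IH] v.
- move=> _; suff -> : map_tuple (v^~ w) (map_tuple (rename x y) t) =
    map_tuple ((update v x (v y w))^~ w) t by [].
  by apply: val_inj => /=; rewrite -map_comp; apply: eq_map => z /=.
- by rewrite !vr.
- by move=> /IH ->.
- by move=> /andP[/IHA -> /IHB ->].
- case: (eqVneq z x) => [<- _|zx] /=.
    by apply: (@sat_ext (All z A)) => u /= /andP[uz _]; rewrite update_neq.
  (* The two updates concern different variables. Commutation at [w] alone suffices, by
     [sat_ext]. *)
  have swap (a : dom w) u : update (update v x (v y w)) z a u w =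
      update (update v z a) x (v y w) u w.
    case: (eqVneq u z) => [->|uz]; first by rewrite update_eq update_neq ?update_eq.
    case: (eqVneq u x) => [->|ux]; last by rewrite !update_neq.
    by rewrite update_neq ?update_eq // eq_sym.
  move=> /orP[xA|/andP[zy adm]].
    rewrite subst_not_free //; apply: (@sat_ext (All z A)) => u /andP[_ uA].
    by rewrite update_neq //; apply: contraNneq xA => <-.
  have vy (a : dom w) : v y w = update v z a y w by rewrite update_neq // eq_sym.
  split=> H a.
    rewrite (@sat_ext _ _ (update (update v z a) x (v y w))) // (vy a).
    exact/IH.
  apply/IH => //; rewrite -vy.
  by rewrite -(@sat_ext _ (update (update v x (v y w)) z a)).
Qed.

Lemma sat_pinst v w s p :
  sat v w (pinst s p) <-> peval (fun i => `[< sat v w (s i) >]) p.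
Proof.
elim: p => [i|p IH|p IHp q IHq] /=; first by rewrite asboolE.
- by rewrite IH; split=> /negP.
- by rewrite IHp IHq; split=> [h|/implyP//]; apply/implyP.
Qed.

Lemma FOL_sound A : FOL A -> models S A.
Proof.
elim=> {A}.
- by move=> p s tp _ v w; apply/sat_pinst.
- by move=> x y A _ adm v w /= h; apply/sat_subst.
- move=> x A B _ _ xA v w /= h hA a; apply: h.
  rewrite (@sat_ext _ _ v) // => z zA; rewrite update_neq //.
  by apply: contraNneq xA => <-.
- by move=> x v w.
- move=> x y A _ adm v w /= h; apply/sat_subst => //.
  have [e hA] : v x w = v y w /\ sat v w A.
    by apply: contrapT => n; apply: h => e hA; apply: n.
  rewrite (@sat_ext _ _ v) // => z _; case: (eqVneq z x) => [->|zx].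
    by rewrite update_eq.
  by rewrite update_neq.
- move=> A B _ IHAB _ IHA v w; exact: (IHAB v w (IHA v w)).
- by move=> x A _ IH v w a; apply: IH.
Qed.

End Semantics.

(** * Completeness of first-order logic *)

Ltac add_atom F l := match l with
  | context [F :: _] => l
  | _ => constr:(F :: l)
  end.
Ltac atoms F l := match F with
  | Neg ?A => atoms A l
  | Imp ?A ?B => let l' := atoms A l in atoms B l'
  | And ?A ?B => let l' := atoms A l in atoms B l'
  | _ => add_atom F l
  end.
Ltac atom_index F l := match l with
  | F :: _ => constr:(0)
  | _ :: ?l' => let n := atom_index F l' in constr:(n.+1)
  end.
Ltac reify F l := match F with
  | Neg ?A => let p := reify A l in constr:(PNeg p)
  | Imp ?A ?B =>
      let p := reify A l in let q := reify B l in constr:(PImp p q)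
  | And ?A ?B =>
      let p := reify A l in let q := reify B l in constr:(PNeg (PImp p (PNeg q)))
  | _ => let n := atom_index F l in constr:(PVar n)
  end.
Ltac prove_tautology :=
  let e := fresh "e" in intro e; cbn [peval];
  repeat match goal with |- context [e ?i] => case: (e i) end; reflexivity.
Ltac box_freeness :=
  rewrite /= ?box_free_subst; repeat (apply/andP; split); done.
(* Proves goals [FOL F] and [FOLBox F] where F is an instance of a
   propositional tautology. *)
Ltac taut := lazymatch goal with
  | |- FOL ?F =>
      let l := atoms F (@nil formula) in let p := reify F l in
      apply: (@FOL_taut p (nth (Eq 0 0) l)); [prove_tautology | box_freeness]
  | |- FOLBox ?F =>
      let l := atoms F (@nil formula) in let p := reify F l in
      apply: (@FOLBox_taut p (nth (Eq 0 0) l)); prove_tautology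
  end.

(** The fresh [y] plays the role of a Henkin constant: generalise over it, move the quantifier past
    [H], then rename the bound variable back to [x]. *)
Lemma FOL_witness H x y B :
  box_free H -> box_free B -> var_bound H <= y -> var_bound B <= y -> x != y ->
  FOL (Imp H (subst x y B)) -> FOL (Imp H (All x B)).
Proof.
move=> bH bB Hy By xy d.
have bS : box_free (subst x y B) by rewrite box_free_subst.
have d1 : FOL (Imp H (All y (subst x y B))).
  by apply: FOL_mp (FOL_gen y d); apply: FOL_dist; rewrite ?ab_free_fresh.
have d2 : FOL (Imp (All y (subst x y B)) (All x B)).
  apply: (@FOL_mp (All x (Imp (All y (subst x y B)) B))).
    by apply: FOL_dist; rewrite //= negb_and subst_fresh_free ?orbT.
  apply: FOL_gen; rewrite -{2}(subst_freshK x By).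
  by apply: FOL_inst => //; apply: admissible_freshK.
apply: FOL_mp d1; apply: FOL_mp d2; taut.
Qed.

Lemma FOL_imp_trans A B C : FOL (Imp A B) -> FOL (Imp B C) -> FOL (Imp A C).
Proof.
move=> AB BC; have /= /andP[bA bB] := FOL_box_free AB.
have /= /andP[_ bC] := FOL_box_free BC.
apply: FOL_mp BC; apply: FOL_mp AB; taut.
Qed.

(** Theses of [FOL] carry no premises, so a finite set of hypotheses is represented by its
    conjunction [G]. *)
Definition consistent (G : formula) : Prop := ~ FOL (Neg G).

Record saturated (T : formula -> Prop) : Prop := Saturated {
  saturated_thesis : forall A, FOL A -> T A;
  saturated_mp : forall A B, T (Imp A B) -> T A -> T B;
  saturated_consistent : forall A, T (Neg A) -> ~ T A;
  saturated_complete : forall A, box_free A -> T A \/ T (Neg A);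
  (* Asking for arbitrarily large witnesses makes every equality class of
     variables infinite, so that no renaming of bound variables is needed. *)
  saturated_witness : forall x B, T (Neg (All x B)) ->
    forall m, exists2 y, m <= y & T (Neg (subst x y B))
}.

(** * Lindenbaum extension to a Henkin theory, with variables as constants *)

Section Lindenbaum.

(** Embeds formulas into a countable type, so that they can be enumerated. Labels 0 to 4 are taken
    by the other constructors, and the arity of an atom is recovered as the number of leaves. *)
Fixpoint code (A : formula) : GenTree.tree nat :=
  match A with
  | Pred _ j t => GenTree.Node j.+1.+4 (map (@GenTree.Leaf nat) t)
  | Eq x y => GenTree.Node 0 [:: GenTree.Leaf x; GenTree.Leaf y]
  | Neg B => GenTree.Node 1 [:: code B]
  | Imp B C => GenTree.Node 2 [:: code B; code C]
  | All x B => GenTree.Node 3 [:: GenTree.Leaf x; code B]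
  | Box B => GenTree.Node 4 [:: code B]
  end.

Definition leaf_val (t : GenTree.tree nat) : nat :=
  if t is GenTree.Leaf x then x else 0.

Fixpoint decode (t : GenTree.tree nat) : formula :=
  match t with
  | GenTree.Node 0 [:: x; y] => Eq (leaf_val x) (leaf_val y)
  | GenTree.Node 1 [:: t] => Neg (decode t)
  | GenTree.Node 2 [:: t; u] => Imp (decode t) (decode u)
  | GenTree.Node 3 [:: x; t] => All (leaf_val x) (decode t)
  | GenTree.Node 4 [:: t] => Box (decode t)
  | GenTree.Node (S (S (S (S (S j))))) s => Pred j (in_tuple (map leaf_val s))
  | _ => Eq 0 0
  end.

Lemma codeK : cancel code decode.
Proof.
elim=> [n j t|//|A IH|A IHA B IHB|x A IH|A IH] /=; rewrite ?IH ?IHA ?IHB //.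
rewrite -map_comp map_id; case: t => s sn /=; have e := eqP sn.
by move: sn; rewrite -e => sn; congr (Pred j _); apply: val_inj.
Qed.

(** The second component is a lower bound for the witness: each negated universal formula comes up
    with every bound, and so can receive arbitrarily large witnesses. *)
Definition task (n : nat) : formula * nat :=
  if unpickle n is Some tm then (decode tm.1, tm.2) else (Eq 0 0, 0).

Lemma task_surj A m : exists n, task n = (A, m).
Proof. by exists (pickle (code A, m)); rewrite /task pickleK /= codeK. Qed.

(** Box-freeness is tested separately because [FOL] never refutes a formula containing a box. An
    accepted [Neg (All x B)] receives its counterexample at once, named by a variable fresh for the
    whole conjunction. *)
Definition extend (G A : formula) (m : nat) : formula :=
  if `[< box_free A /\ consistent (And G A) >] then
    let H := And G A in
    if A is Neg (All x B) then
      And H (Neg (subst x (maxn m (var_bound H)) B))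
    else H
  else G.

(** If adding the counterexample were inconsistent, [H] would prove the instance of [B], hence
    [All x B] by [FOL_witness], against its own conjunct [Neg (All x B)]. *)
Lemma consistent_extend G A m :
  box_free G -> consistent G ->
  box_free (extend G A m) /\ consistent (extend G A m).
Proof.
move=> bG cG; rewrite /extend; case: asboolP => // -[bA cGA].
have bGA : box_free (And G A) by rewrite /= bG.
case: A bA cGA bGA => // -[] // x B /= bB cGA bGA.
set H := And G _; set y := maxn m _.
have : var_bound H <= y by rewrite leq_maxr.
rewrite /H /= !geq_max => /and3P[Gy xy By].
split; first by rewrite /= bG bB box_free_subst.
move=> d; apply: cGA.
have d1 : FOL (Imp H (All x B)).
  apply: (@FOL_witness _ _ y) => //; first by rewrite leq_maxr.
    by rewrite neq_ltn xy.
  apply: FOL_mp d; rewrite /H; taut.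
apply: FOL_mp d1; rewrite /H; taut.
Qed.

Lemma extend_imp G A m : box_free G -> box_free A -> consistent (And G A) ->
  FOL (Imp (extend G A m) (And G A)).
Proof.
move=> bG bA c; rewrite /extend asboolT //.
have t : FOL (Imp (And G A) (And G A)) by taut.
case: A t bA {c} => [? ? ?|? ?|A|? ?|? ?|?] t bA; try exact: t.
case: A t bA => [? ? ?|? ?|?|? ?|x B|?] t bA; try exact: t.
by move: bA => /= bA; taut.
Qed.

Lemma extend_witness G x B m :
  box_free G -> box_free B -> consistent (And G (Neg (All x B))) ->
  exists2 y, m <= y & FOL (Imp (extend G (Neg (All x B)) m) (Neg (subst x y B))).
Proof.
move=> bG bB c; exists (maxn m (var_bound (And G (Neg (All x B))))).
  exact: leq_maxl.
by rewrite /extend asboolT //; cbv zeta; taut.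
Qed.

Lemma extend_mono G A m : box_free G -> FOL (Imp (extend G A m) G).
Proof.
move=> bG; have [[bA c]|n] := pselect (box_free A /\ consistent (And G A)).
  by apply: FOL_imp_trans (extend_imp m bG bA c) _; taut.
by rewrite /extend asboolF //; taut.
Qed.

Variable A0 : formula.
Hypothesis A0_box_free : box_free A0.
Hypothesis A0_consistent : consistent A0.

Fixpoint stage (n : nat) : formula :=
  if n is k.+1 then extend (stage k) (task k).1 (task k).2 else A0.

Definition lindenbaum (A : formula) : Prop := exists n, FOL (Imp (stage n) A).

Lemma stage_consistent n : box_free (stage n) /\ consistent (stage n).
Proof. by elim: n => //= n [bn cn]; apply: consistent_extend. Qed.

Lemma stage_box_free n : box_free (stage n).
Proof. by have [] := stage_consistent n. Qed.

Lemma stage_imp m n : m <= n -> FOL (Imp (stage n) (stage m)).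
Proof.
elim: n => [|n IH]; first by rewrite leqn0 => /eqP ->; taut.
rewrite leq_eqVlt ltnS => /orP[/eqP ->|/IH].
  by have b := stage_box_free n.+1; taut.
apply: FOL_imp_trans; exact/extend_mono/stage_box_free.
Qed.

Lemma lindenbaum_init : lindenbaum A0.
Proof. by exists 0; rewrite /=; taut. Qed.

Lemma lindenbaum_saturated : saturated lindenbaum.
Proof.
have up A m n : m <= n -> FOL (Imp (stage m) A) -> FOL (Imp (stage n) A).
  by move=> /stage_imp; apply: FOL_imp_trans.
have cons A : lindenbaum (Neg A) -> ~ lindenbaum A.
  move=> [m hm] [n hn]; have [bk] := stage_consistent (maxn m n); apply.
  have {}hm := up _ _ _ (leq_maxl m n) hm.
  have {}hn := up _ _ _ (leq_maxr m n) hn.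
  have /= /andP[_ bA] := FOL_box_free hn.
  apply: FOL_mp hn; apply: FOL_mp hm; taut.
have inc A n : box_free A -> ~ consistent (And (stage n) A) -> lindenbaum (Neg A).
  move=> bA /contrapT d; exists n; have bn := stage_box_free n.
  apply: FOL_mp d; taut.
split=> // [A dA|A B [m hm] [n hn]|A bA|x B TB m].
- by exists 0; have bA := FOL_box_free dA; apply: FOL_mp dA; rewrite /=; taut.
- exists (maxn m n).
  have {}hm := up _ _ _ (leq_maxl m n) hm.
  have {}hn := up _ _ _ (leq_maxr m n) hn.
  have /= /and3P[bs bA bB] := FOL_box_free hm.
  apply: FOL_mp hn; apply: FOL_mp hm; taut.
(* No particular witness is wanted here, so any bound would do. *)
- have [n tn] := task_surj A 0.
  have [c|/inc] := pselect (consistent (And (stage n) A)); last by right; auto.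
  left; exists n.+1.
  apply: (@FOL_imp_trans _ (And (stage n) A)).
    by rewrite /= tn; apply: extend_imp => //; apply: stage_box_free.
  by have bn := stage_box_free n; taut.
(* At the stage that treats this pair the formula is accepted: otherwise its negation would belong
   to the theory, against [TB]. *)
- have [n tn] := task_surj (Neg (All x B)) m.
  have [k] := TB => /FOL_box_free /= /andP[_ bB].
  have [c|/inc] := pselect (consistent (And (stage n) (Neg (All x B)))); last first.
    by move=> /(_ bB) /cons.
  have [y my d] := extend_witness m (stage_box_free n) bB c.
  by exists y => //; exists n.+1; rewrite /= tn.
Qed.

End Lindenbaum.

(** * The canonical structure and its truth lemma *)

Record canon_world : Type := CanonWorld {
  theory :> formula -> Prop;
  theory_saturated : saturated theory
}.

Lemma exists_canon_world A : box_free A -> ~ FOL A ->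
  exists w : canon_world, theory w (Neg A).
Proof.
move=> bA nA; have cA : consistent (Neg A).
  by move=> d; apply: nA; apply: FOL_mp d; taut.
exists (CanonWorld (@lindenbaum_saturated (Neg A) bA cA)).
exact: lindenbaum_init.
Qed.

Section World.
Variable w : canon_world.
Let thm := saturated_thesis (theory_saturated w).
Let mp := saturated_mp (theory_saturated w).

Lemma theory_neg A : box_free A -> w (Neg A) <-> ~ w A.
Proof.
move=> bA; split; first exact: saturated_consistent (theory_saturated w) _.
by case: (saturated_complete (theory_saturated w) bA).
Qed.

Lemma theory_imp A B : box_free A -> box_free B ->
  w (Imp A B) <-> (w A -> w B).
Proof.
move=> bA bB; split=> [|h]; first exact: mp.
have [wA|nA] := pselect (w A).
  by apply: mp (h wA); apply: thm; taut.
by apply: mp ((theory_neg bA).2 nA); apply: thm; taut.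
Qed.

Lemma theory_refl x : w (Eq x x).
Proof. exact/thm/FOL_refl. Qed.

Lemma theory_leib x y A : box_free A -> admissible x y A ->
  w (Eq x y) -> w A -> w (subst x y A).
Proof.
move=> bA adm xy wA; have xyA : w (And (Eq x y) A).
  by apply: mp wA; apply: mp xy; apply: thm; taut.
by apply: mp xyA; apply/thm/FOL_leib.
Qed.

Lemma theory_sym x y : w (Eq x y) -> w (Eq y x).
Proof.
move=> xy; case: (eqVneq x y) => [<-|nxy]; first exact: theory_refl.
(* Substituting y for x in x = x would rewrite both sides, so refute y <> x
   instead. *)
apply: contrapT => /(theory_neg (A := Eq y x) isT).2 nyx.
have := theory_leib (A := Neg (Eq y x)) isT isT xy nyx.
rewrite /= /rename eqxx eq_sym (negbTE nxy) => /(theory_neg (A := Eq y y) isT).1.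
by apply; apply: theory_refl.
Qed.

Lemma theory_trans x y z : w (Eq x y) -> w (Eq y z) -> w (Eq x z).
Proof.
move=> xy yz; case: (eqVneq x y) => [-> //|nxy].
have := theory_leib (A := Eq x y) isT isT yz xy.
by rewrite /= /rename eqxx (negbTE nxy).
Qed.

(** [epsilon] depends on the predicate alone, so by extensionality all members of an equality class
    get the same representative. *)
Definition rep (x : nat) : nat := epsilon (inhabits 0) (fun y => w (Eq x y)).

Lemma rep_eq x : w (Eq x (rep x)).
Proof.
apply: (epsilon_spec (inhabits 0) (fun y => w (Eq x y))).
by exists x; apply: theory_refl.
Qed.

Lemma rep_theory x y : rep x = rep y <-> w (Eq x y).
Proof.
split=> [e|xy].
  apply: theory_trans (rep_eq x) _; rewrite e.
  exact/theory_sym/rep_eq.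
rewrite /rep; congr epsilon; apply: funext => z; apply: propext.
by split; apply: theory_trans => //; apply: theory_sym.
Qed.

Lemma repK x : rep (rep x) == rep x.
Proof. exact/eqP/rep_theory/theory_sym/rep_eq. Qed.

(** That something equals [x] is a thesis of the form of a negated universal formula, so saturation
    gives it arbitrarily large witnesses. The bound variable [x.+1] only has to differ from [x]. *)
Lemma theory_fresh_eq x m : exists2 y, m <= y & w (Eq y x).
Proof.
have ex : FOL (Neg (All x.+1 (Neg (Eq x.+1 x)))).
  have i : FOL (Imp (All x.+1 (Neg (Eq x.+1 x))) (Neg (Eq x x))).
    have := @FOL_inst x.+1 x (Neg (Eq x.+1 x)) isT isT.
    by rewrite /= /rename eqxx ltn_eqF.
  by apply: FOL_mp (FOL_refl x); apply: FOL_mp i; taut.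
have [y my] := saturated_witness (theory_saturated w) (thm ex) m.
rewrite /= /rename eqxx ltn_eqF // => nny; exists y => //.
by apply: mp nny; apply: thm; taut.
Qed.

(* Renaming one variable after the other collapses each class onto its
   representative; completeness supplies the converse implication. *)
Lemma theory_pred_rep n j (t : n.-tuple nat) :
  w (Pred j (map_tuple rep t)) <-> w (Pred j t).
Proof.
have step (F : n.-tuple nat -> formula) :
    (forall s, box_free (F s)) -> (forall x y s, admissible x y (F s)) ->
    (forall x y s, subst x y (F s) = F (map_tuple (rename x y) s)) ->
    w (F t) -> w (F (map_tuple rep t)).
  move=> bF aF sF wt.
  pose f (l : seq nat) z := if z \in l then rep z else z.
  have fw : forall l, w (F (map_tuple (f l) t)).
    elim=> [|x l IH].
      by suff -> : map_tuple (f [::]) t = t by []; apply: val_inj; apply: map_id.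
    have := theory_leib (bF _) (aF _ _ _) (rep_eq x) IH; rewrite sF.
    suff -> : map_tuple (rename x (rep x)) (map_tuple (f l) t) =
      map_tuple (f (x :: l)) t by [].
    apply: val_inj => /=; rewrite -map_comp; apply: eq_map => z /=.
    rewrite /rename /f inE; case: (eqVneq z x) => [->|zx] /=.
      by case: (x \in l); rewrite ?eqxx //; case: ifP.
    case: (z \in l); last by rewrite (negbTE zx).
    (* If the representative [rep z] put in earlier is [x] itself, renaming [x] to [rep x] leaves it
       unchanged because [rep] is idempotent. *)
    by case: eqP => // <-; apply/eqP/repK.
  suff <- : map_tuple (f t) t = map_tuple rep t by [].
  by apply: val_inj; apply/eq_in_map => z zt; rewrite /f zt.
split=> [wr|]; last exact: (step (@Pred n j)).
apply: contrapT => /(theory_neg (A := Pred j t) isT).2.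
by move=> /(step (fun s => Neg (Pred j s))) /(theory_neg (A := Pred j _) isT).1; apply.
Qed.

End World.

(** A one-point structure shows by soundness that [Neg (Eq 0 0)] is no thesis, and any box-free
    non-thesis yields a world. *)
Lemma canon_world_inh : inhabited canon_world.
Proof.
pose U := @Structure unit (inhabits tt) (fun=> unit) (fun=> inhabits tt)
  (fun _ _ _ _ => False).
have nU : ~ FOL (Neg (Eq 0 0)).
  by move=> /(@FOL_sound U) /(_ (fun _ _ => tt) tt) /=; apply.
by have [w _] := @exists_canon_world (Neg (Eq 0 0)) isT nU.
Qed.

(** The quotient of the variables by equality in [w], realised as the set of chosen
    representatives. *)
Definition canon_dom (w : canon_world) : Type := {x : nat | rep w x == x}.

Definition canon_elt (w : canon_world) (x : nat) : canon_dom w :=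
  exist _ (rep w x) (repK w x).

Definition canon : structure := @Structure canon_world canon_world_inh
  canon_dom (fun w => inhabits (canon_elt w 0))
  (fun n j w t => w (Pred j (map_tuple sval t))).

Definition canon_val : valuation canon := fun x w => canon_elt w x.

Lemma canon_elt_eq (w : canon_world) x y :
  canon_elt w x = canon_elt w y <-> w (Eq x y).
Proof.
rewrite -rep_theory; split=> [[]//|e].
exact: val_inj.
Qed.

(** Large names are needed so that an element can be named by a variable whose substitution is
    admissible in a given formula. *)
Lemma canon_elt_surj (w : canon_world) (a : canon_dom w) m :
  exists2 y, m <= y & a = canon_elt w y.
Proof.
case: a => x rx; have [y my yx] := theory_fresh_eq w x m; exists y => //.
by apply: val_inj => /=; rewrite -(eqP rx); apply/rep_theory/theory_sym.
Qed.

(** Induction is on height, since the quantifier case passes to substitution instances. There,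
    saturation supplies a counterexample to a universal formula outside [w], and fresh names reach
    every element of the domain. *)
Lemma truth (w : canon_world) A : box_free A ->
  sat canon_val (w : world canon) A <-> w A.
Proof.
have [n] := ubnP (height A); elim: n A => // n IH.
case=> [k j t|x y|A|A B|x A|A] //= hA bA.
- have -> : map_tuple sval (map_tuple (canon_val^~ w) t) = map_tuple (rep w) t.
    by apply: val_inj => /=; rewrite -map_comp.
  exact: theory_pred_rep.
- exact: canon_elt_eq.
- by rewrite theory_neg // IH.
- move: hA bA; rewrite ltnS gtn_max => /andP[hA hB] /andP[bA bB].
  by rewrite theory_imp // !IH.
- split=> [h|wA a].
    apply: contrapT => /(theory_neg w (A := All x A) bA).2.
    move=> /(saturated_witness (theory_saturated w)) /(_ (var_bound A)) [y Ay].
    move=> /(theory_neg w (A := subst x y A)); rewrite box_free_subst => /(_ bA); apply.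
    apply/IH; rewrite ?height_subst ?box_free_subst //.
    by apply/sat_subst; [exact: admissible_fresh | exact: h].
  have [y Ay ->] := canon_elt_surj a (var_bound A).
  apply/(@sat_subst canon A x y canon_val w); first exact: admissible_fresh.
  apply/IH; rewrite ?height_subst ?box_free_subst //.
  apply: saturated_mp (theory_saturated w) _ _ _ wA.
  by apply/(saturated_thesis (theory_saturated w))/FOL_inst/admissible_fresh.
Qed.

(** A box-free non-thesis fails under [canon_val] at a world containing its negation. *)
Lemma canon_complete A : box_free A -> models canon A -> FOL A.
Proof.
move=> bA mA; apply: contrapT => /(exists_canon_world bA) [w wA].
have /(theory_neg w bA).1 := wA; apply.
by apply/truth => //; apply: mA.
Qed.

Lemma canon_universal : universal canon.
Proof. by move=> A bA /(canon_complete bA) dA T; apply: FOL_sound. Qed.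

(** * Elimination of boxes *)

(** [Eq 0 0] and its negation serve as truth and falsehood. *)
Fixpoint unbox (A : formula) : formula :=
  match A with
  | Neg B => Neg (unbox B)
  | Imp B C => Imp (unbox B) (unbox C)
  | All x B => All x (unbox B)
  | Box B => if `[< FOL (unbox B) >] then Eq 0 0 else Neg (Eq 0 0)
  | _ => A
  end.

Lemma box_free_unbox A : box_free (unbox A).
Proof. by elim: A => //= [A -> B ->|A _] //; case: ifP. Qed.

(** Generalisation is not a primitive rule of [FOLBox]; it comes from necessitation through
    [FOLBox_all]. *)
Lemma FOLBox_gen x A : FOLBox A -> FOLBox (All x A).
Proof. by move=> d; apply: FOLBox_mp (FOLBox_nec d); apply: FOLBox_all. Qed.

Lemma FOL_FOLBox A : FOL A -> FOLBox A.
Proof.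
elim=> {A} [p s tp _|x y A _ adm|x A B _ _ xA|x|x y A bA adm|A B _ + _|x A _].
- exact: FOLBox_taut.
- exact: FOLBox_inst.
- exact: FOLBox_dist.
- exact: FOLBox_refl.
- exact: FOLBox_leib.
- exact: FOLBox_mp.
- exact: FOLBox_gen.
Qed.

Lemma subst_id x A : subst x x A = A.
Proof.
have r z : rename x x z = z by rewrite /rename; case: eqP.
elim: A => //= [n j t|a b|A ->|A -> B ->|z A ->] //; rewrite ?r ?if_same //.
by congr (Pred j _); apply: val_inj; rewrite /= (eq_map r) map_id.
Qed.

Lemma admissible_id x A : admissible x x A.
Proof.
elim: A => //= [A -> B -> //|z A ->].
by rewrite andbT (eq_sym z x); case: (x == z); rewrite ?orbT.
Qed.

Lemma FOLBox_imp_trans A B C :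
  FOLBox (Imp A B) -> FOLBox (Imp B C) -> FOLBox (Imp A C).
Proof. by move=> AB BC; apply: FOLBox_mp BC; apply: FOLBox_mp AB; taut. Qed.

(** Instantiate [x] by itself, compose, generalise, and distribute the quantifier past [All x A],
    where [x] is not free. *)
Lemma FOLBox_all_mono x A B :
  FOLBox (Imp A B) -> FOLBox (Imp (All x A) (All x B)).
Proof.
move=> AB; have dA : FOLBox (Imp (All x A) A).
  by rewrite -{2}(subst_id x A); apply/FOLBox_inst/admissible_id.
apply: FOLBox_mp (FOLBox_gen x (FOLBox_imp_trans dA AB)).
by apply: FOLBox_dist; rewrite /= eqxx.
Qed.

Lemma FOLBox_box_mono A B :
  FOLBox (Imp A B) -> FOLBox (Imp (Box A) (Box B)).
Proof. by move=> /FOLBox_nec; apply: FOLBox_mp; apply: FOLBox_K. Qed.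

Lemma FOLBox_unbox A : FOLBox (Imp A (unbox A)) /\ FOLBox (Imp (unbox A) A).
Proof.
elim: A => [n j t|x y|A [d e]|A [dA eA] B [dB eB]|x A [d e]|A [d e]] /=.
- by split; taut.
- by split; taut.
- by split; [apply: FOLBox_mp e | apply: FOLBox_mp d]; taut.
- by split; [apply: FOLBox_mp dB; apply: FOLBox_mp eA |
             apply: FOLBox_mp eB; apply: FOLBox_mp dA]; taut.
- by split; apply: FOLBox_all_mono.
- have [dU|nU] := asboolP.
    split; first by apply: FOLBox_mp (FOLBox_refl 0); taut.
    have dB : FOLBox (Box A).
      exact/FOLBox_nec/(FOLBox_mp e)/FOL_FOLBox.
    by apply: FOLBox_mp dB; taut.
  (* The axiom reaches only box-free formulas, so it refutes [Box (unbox A)]; monotonicity of the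
     box along [d] carries the refutation to [Box A]. *)
  have nB : FOLBox (Neg (Box A)).
    apply: FOLBox_mp (FOLBox_nonthesis (box_free_unbox A) nU).
    by apply: FOLBox_mp (FOLBox_box_mono d); taut.
  split; first by apply: FOLBox_mp nB; taut.
  by apply: FOLBox_mp (FOLBox_refl 0); taut.
Qed.

(** In the box case both sides depend only on validity in [canon], which for the box-free reduct
    coincides with being a thesis, by [FOL_sound] and [canon_complete]. *)
Lemma sat_unbox A (v : valuation canon) (w : world canon) :
  sat v w (unbox A) <-> sat v w A.
Proof.
elim: A v w => //= [A IH|A IHA B IHB|x A IH|A IH] v w.
- by rewrite IH.
- by rewrite IHA IHB.
- by split=> h a; apply/IH.
- have [dU|nU] := asboolP.
    by split=> // _ v' w'; apply/IH; apply: FOL_sound.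
  split=> [/(_ erefl)//|h]; case: nU; apply: (canon_complete (box_free_unbox A)).
  by move=> v' w'; apply/IH.
Qed.

Theorem theorem3 (A : formula) : logically_valid A -> FOLBox A.
Proof.
move=> /(_ canon canon_universal) mA.
apply: FOLBox_mp (FOLBox_unbox A).2 _; apply: FOL_FOLBox.
apply: (canon_complete (box_free_unbox A)) => v w.
by apply/sat_unbox.
Qed.
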